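(* If $G$ is a finite, connected, $d$-regular simple graph with diameter at least $3$, then \[\min_{v,r}\delta(\overline{\mathcal{L}}_r(v))\leq\left\lfloor (2d-1)/3\right\rfloor,\] where the minimum is over all vertices $v$ of $G$ and all integers $r\ge 1$. Moreover, for every $d\equiv 2\pmod 3$ and every $D\ge 3$ there exists a finite, connected, $d$-regular graph of diameter at least $D$ for which equality holds.
   Context: For a graph $G$, a vertex $v$ and an integer $r\ge 1$, the ball $\mathcal{B}_r(v)=\{w\in V(G): d(v,w)\le r\}$ is the set of vertices at graph distance at most $r$ from $v$, and $\overline{\mathcal{L}}_r(v)=G[\mathcal{B}_r(v)]$ is the subgraph induced by it. $\delta(H)$ denotes the minimum degree of a graph $H$. *)

(* Defs.v *)
From mathcomp Require Import all_boot.

Set Implicit Arguments.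
Unset Strict Implicit.
Unset Printing Implicit Defensive.

Record sgraph := SGraph {
  vertex :> finType;
  edge : rel vertex;
  edge_sym : symmetric edge;
  edge_irr : irreflexive edge }.

Definition deg (G : sgraph) (v : G) : nat := #|[set w | edge v w]|.

Definition regular (d : nat) (G : sgraph) : Prop := forall v : G, deg v = d.

Definition connected (G : sgraph) : Prop :=
  0 < #|G| /\ forall u v : G, connect (@edge G) u v.

Definition walk (G : sgraph) (n : nat) (u v : G) : bool :=
  [exists p : n.-tuple G, path (@edge G) u p && (last u p == v)].

(* A shortest walk has fewer than #|G| edges, so the restriction n < #|G| loses
   nothing; #|G| is the (junk) value when u and v lie in different components. *)
Definition dist (G : sgraph) (u v : G) : nat :=
  \big[minn/#|G|]_(n < #|G| | walk n u v) n.

Definition diam (G : sgraph) : nat := \max_(u : G) \max_(v : G) dist u v.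

Definition ball (G : sgraph) (r : nat) (v : G) : {set G} :=
  [set w | dist v w <= r].

Section Induced.
Variables (G : sgraph) (A : {set G}).

Definition induced_edge : rel {x : G | x \in A} :=
  fun x y => edge (val x) (val y).

Fact induced_sym : symmetric induced_edge.
Proof. by move=> x y; apply: edge_sym. Qed.

Fact induced_irr : irreflexive induced_edge.
Proof. by move=> x; apply: edge_irr. Qed.

Definition induced : sgraph := SGraph induced_sym induced_irr.
End Induced.

(* Every degree is smaller than #|H|, so the default value #|H| of the empty
   minimum is never attained when H has a vertex. *)
Definition min_deg (H : sgraph) : nat := \big[minn/#|H|]_(v : H) deg v.

Definition local_graph (G : sgraph) (r : nat) (v : G) : sgraph :=
  induced (ball r v).

Definition is_minimum (P : nat -> Prop) (m : nat) : Prop :=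
  P m /\ forall n, P n -> m <= n.

Definition is_min_local_deg (G : sgraph) (m : nat) : Prop :=
  is_minimum
    (fun k => exists (v : G) (r : nat), 1 <= r /\ k = min_deg (local_graph r v))
    m.

(* Main.v *)
Require Import Defs.
From mathcomp Require Import all_boot.
From mathcomp Require Import zify.

Set Implicit Arguments.
Unset Strict Implicit.
Unset Printing Implicit Defensive.

(** Upper bound: radius-one balls suffice.  If all of them have minimum degree
    at least [m], then across every edge [xy] at least [m] neighbours of [y] lie
    in the closed neighbourhood [N[x]].  Take a geodesic [x0 x1 x2 x3].  At least
    [m] neighbours of [x1] lie in [N[x0]] and at least [m] neighbours of [x2] in
    [N[x3]]; as [N[x0]] and [N[x3]] are disjoint, each of the [m] neighbours of
    [x2] in [N[x1]] is one of the at most [d - m] neighbours of [x2] outside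
    [N[x3]], or one of the at most [d - m] neighbours of [x1] outside [N[x0]],
    the vertex [x2] itself being excluded.  Hence [m <= 2 (d - m) - 1].

    Equality for [d = 3 t + 2]: replace each vertex of a long cycle by a clique
    on [t + 1] vertices.  A ball is a union of cliques, and with each clique it
    contains an adjacent one, so its minimum degree is at least
    [2 (t + 1) - 1 = (2 d - 1) / 3]. *)

(** * Minima over a finite type with a default value *)

Lemma bigmin_leq (I : finType) (P : pred I) (F : I -> nat) x j :
  P j -> \big[minn/x]_(i | P i) F i <= F j.
Proof.
move=> Pj; have: j \in index_enum I by rewrite mem_index_enum.
elim: (index_enum I) => // a s IH; rewrite inE big_cons.
case/orP=> [/eqP <-|/IH le_j]; first by rewrite Pj geq_minl.
by case: ifP => // _; rewrite geq_min le_j orbT.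
Qed.

Lemma bigmin_attained (I : finType) (P : pred I) (F : I -> nat) x :
  \big[minn/x]_(i | P i) F i = x \/
  exists2 j, P j & \big[minn/x]_(i | P i) F i = F j.
Proof.
apply: (big_ind (fun m => m = x \/ exists2 j, P j & m = F j)); first by left.
- by move=> a b Ha Hb; rewrite /minn; case: ifP.
- by move=> i Pi; right; exists i.
Qed.

(** * Distances and balls through walks of bounded length *)

Section Distance.
Variable G : sgraph.

(** Only an upper bound on the length is kept, so walks compose by concatenation and spare steps are
    harmless. *)
Definition reach (n : nat) (u v : G) : Prop :=
  exists p, [/\ path (@edge G) u p, last u p = v & size p <= n].

Lemma reach_refl n u : reach n u u.
Proof. by exists [::]. Qed.

Lemma reach_edge n u v w : edge u v -> reach n v w -> reach n.+1 u w.
Proof. by move=> uv [p [pp <- sp]]; exists (v :: p); rewrite /= uv. Qed.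

Lemma reach_trans m n u v w : reach m u v -> reach n v w -> reach (m + n) u w.
Proof.
move=> [p [pp <- sp]] [q [pq <- sq]]; exists (p ++ q).
by rewrite cat_path pp pq last_cat size_cat leq_add.
Qed.

Lemma dist_leq_card (u v : G) : dist u v <= #|G|.
Proof.
rewrite /dist.
by case: (bigmin_attained (fun n : 'I__ => walk n u v) (@nat_of_ord #|G|) #|G|)
  => [|[j _]] ->; rewrite // ltnW.
Qed.

(** Removing repetitions from [p] leaves a walk with fewer than [#|G|] edges, hence one of the
    indices in the minimum defining [dist]. The strict bound excludes the default value in
    [reach_dist]. *)
Lemma dist_leq_size (u : G) p :
  path (@edge G) u p -> dist u (last u p) <= size p /\ dist u (last u p) < #|G|.
Proof.
move=> pp; case: (shortenP pp) => q pq uq sub_qp.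
have lt_q : size q < #|G| by have /card_uniqP eq_q := uq; rewrite -[X in X <= _]eq_q max_card.
have le_qp : size q <= size p by apply: uniq_leq_size => //; case/andP: uq.
have walk_q : walk (Ordinal lt_q) u (last u q).
  by apply/existsP; exists (in_tuple q); rewrite /= pq eqxx.
have le_d : dist u (last u q) <= size q :=
  @bigmin_leq _ (fun n : 'I__ => walk n u _) (@nat_of_ord #|G|) _ _ walk_q.
by split; [exact: leq_trans le_d le_qp | exact: leq_ltn_trans le_d lt_q].
Qed.

Lemma reach_dist (u v : G) : connected G -> reach (dist u v) u v.
Proof.
move=> [_ /(_ u v) /connectP [p pp ->]].
have [_] := dist_leq_size pp; rewrite /dist.
case: (bigmin_attained (fun n : 'I__ => walk n u (last u p)) (@nat_of_ord #|G|) #|G|)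
  => [->|[j /existsP [q /andP [pq /eqP lq]] ->] _]; first by rewrite ltnn.
by exists q; rewrite size_tuple.
Qed.

Lemma dist_leqP n (u v : G) : connected G -> reflect (reach n u v) (dist u v <= n).
Proof.
move=> cG; apply: (iffP idP) => [le_n | [p [/dist_leq_size [le_p _] <- sp]]].
  by have [p [? ? sp]] := reach_dist u v cG; exists p; split; rewrite // (leq_trans sp).
exact: leq_trans sp.
Qed.

(** A source of lower bounds on distances, used for the diameter of the extremal graph. *)
Lemma dist_lipschitz (f : G -> nat) (u v : G) : connected G ->
  (forall x y : G, edge x y -> f y <= (f x).+1) -> f v <= f u + dist u v.
Proof.
move=> cG lip; have [p [pp <- sp]] := reach_dist u v cG.
apply: leq_trans (leq_add (leqnn _) sp); elim: p u pp {sp} => [|y p IH] u /=.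
  by rewrite addn0.
by case/andP=> /lip uy /IH; lia.
Qed.

(** No distance exceeds [#|G|], so finitely many radii produce all balls; this reduces the minimum
    over all [r] to a decidable search. *)
Lemma ball_minn r (v : G) : ball (minn r #|G|) v = ball r v.
Proof. by apply/setP=> w; rewrite !inE leq_min dist_leq_card andbT. Qed.

Lemma mem_ball1 (v w : G) : connected G -> (w \in ball 1 v) = (w == v) || edge v w.
Proof.
move=> cG; rewrite inE; apply/(dist_leqP _ _ _ cG)/orP.
  move=> [[|x [|y p]] [/= pp <- sp]] //; first by left.
  by right; case/andP: pp.
by move=> [/eqP->|vw]; [exact: reach_refl | apply: reach_edge vw (reach_refl _ _)].
Qed.

Lemma ball_center r (v : G) : connected G -> v \in ball r v.
Proof. by move=> cG; rewrite inE; apply/dist_leqP; last exact: reach_refl. Qed.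

End Distance.

(** * Degrees in induced subgraphs and existence of the minimum over all balls *)

Lemma deg_induced (G : sgraph) (A : {set G}) (w : induced A) :
  deg w = #|[set x in A | edge (val w) x]|.
Proof.
rewrite /deg -(card_imset _ val_inj); congr #|pred_of_set _|.
apply/setP=> x; rewrite !inE; apply/imsetP/andP.
  by move=> [y]; rewrite inE => wy ->; split; first exact: valP.
by move=> [xA wx]; exists (Sub x xA); rewrite ?inE.
Qed.

Lemma min_deg_geq (H : sgraph) (x : H) k :
  (forall v : H, k <= deg v) -> k <= min_deg H.
Proof.
move=> le_k; rewrite /min_deg.
case: (bigmin_attained xpredT (@deg H) #|H|) => [->|[j _ ->] //].
(* The default value [#|H|] is at least the degree of [x]. *)
exact: leq_trans (le_k x) (max_card _).
Qed.

Lemma min_local_deg_exists (G : sgraph) : connected G ->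
  exists m, is_min_local_deg G m.
Proof.
move=> [G_gt0 _].
pose P k := [exists v : G, exists r : 'I_#|G|.+1,
  (0 < r) && (k == min_deg (local_graph r v))].
have PP k : reflect
    (exists (v : G) (r : nat), 1 <= r /\ k = min_deg (local_graph r v)) (P k).
  apply: (iffP existsP) => -[v].
    by case/existsP=> r /andP [r0 /eqP]; exists v, r.
  move=> [r [r0 ->]]; exists v; apply/existsP.
  have lt_r : minn r #|G| < #|G|.+1 by rewrite ltnS geq_minr.
  by exists (Ordinal lt_r); rewrite /= /local_graph ball_minn eqxx leq_min r0 G_gt0.
have exP : exists k, P k.
  have /card_gt0P [v _] := G_gt0.
  by exists (min_deg (local_graph 1 v)); apply/PP; exists v, 1.
by case: (ex_minnP exP) => m /PP Pm min_m; exists m; split=> // n /PP /min_m.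
Qed.

(** * The upper bound from balls of radius one *)

Section UpperBound.
Variables (G : sgraph) (d m : nat).
Hypotheses (cG : connected G) (rG : regular d G).
Hypothesis min_m : is_min_local_deg G m.

Let N (x : G) : {set G} := [set w | edge x w].

(** The right-hand side is the degree of [y] in the local graph of radius one at [x]. *)
Lemma common_neighbours (x y : G) : edge x y -> m <= #|N y :&: ball 1 x|.
Proof.
move=> xy; have yB : y \in ball 1 x by rewrite mem_ball1 // xy orbT.
have [_ /(_ (min_deg (local_graph 1 x)))] := min_m.
move=> /(_ (ex_intro _ x (ex_intro _ 1 (conj isT erefl)))) le_m.
apply: leq_trans le_m _.
have := @bigmin_leq (local_graph 1 x) xpredT (@deg _) #|local_graph 1 x|
  (Sub y yB : {z | z \in ball 1 x}) isT.
rewrite deg_induced => /leq_trans; apply; apply: subset_leq_card.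
by apply/subsetP=> z; rewrite !inE andbC.
Qed.

Lemma outside_neighbours (x y : G) : edge x y -> #|N y :\: ball 1 x| + m <= d.
Proof.
move=> /common_neighbours; have := cardsID (ball 1 x) (N y).
by rewrite -[#|N y|]/(deg y) rG; lia.
Qed.

Lemma min_local_deg_dist3 (x0 x1 x2 x3 : G) :
  edge x0 x1 -> edge x1 x2 -> edge x2 x3 -> ~ @reach G 2 x0 x3 -> 3 * m < 2 * d.
Proof.
move=> e01 e12 e23 far.
have e32 : edge x3 x2 by rewrite edge_sym.
have reach1 x y : y \in ball 1 x -> @reach G 1 x y by rewrite inE => /dist_leqP; apply.
have reach1s x y : x \in ball 1 y -> @reach G 1 x y.
  by rewrite mem_ball1 // eq_sym edge_sym -mem_ball1 //; apply: reach1.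
(* A common vertex would give a walk of length two from [x0] to [x3]. *)
have disj y : y \in ball 1 x0 -> y \in ball 1 x3 = false.
  move=> /reach1 r0y; apply/negP=> /reach1s ry3; apply: far.
  exact: reach_trans r0y ry3.
have x1X : x1 \in ball 1 x0 by rewrite mem_ball1 // e01 orbT.
have x2Y : x2 \in ball 1 x3 by rewrite mem_ball1 // e32 orbT.
have x2A : x2 \in N x1 :\: ball 1 x0.
  rewrite in_setD [in X in _ && X]inE e12 andbT.
  by apply/negP=> /disj; rewrite x2Y.
have := cardsID (ball 1 x3) (N x2 :&: ball 1 x1).
have sub_out : (N x2 :&: ball 1 x1) :\: ball 1 x3 \subset N x2 :\: ball 1 x3.
  by apply: setSD; apply: subsetIl.
have sub_in : (N x2 :&: ball 1 x1) :&: ball 1 x3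
    \subset (N x1 :\: ball 1 x0) :\ x2.
  apply/subsetP=> y; rewrite !in_setI in_setD1 in_setD mem_ball1 //.
  rewrite [y \in N x2]inE [y \in N x1]inE.
  (* [y] is not [x2] as there are no loops, avoids the ball at [x0] by disjointness, and is not
     [x1], which lies in that ball. *)
  case/andP=> /andP [e2y e1y] y3; apply/and3P; split.
  - by apply: contraTneq e2y => ->; rewrite edge_irr.
  - by apply: contraTN y3 => /disj ->.
  - by case/orP: e1y => // /eqP y1; rewrite y1 disj in y3.
(* The count is [m <= (d - m) + (d - m - 1)]; removing [x2] saves the one. *)
have := subset_leq_card sub_out; have := subset_leq_card sub_in.
have := cardsD1 x2 (N x1 :\: ball 1 x0); rewrite x2A.
have := outside_neighbours e01; have := outside_neighbours e32.
by have := common_neighbours e12; lia.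
Qed.

Lemma min_local_deg_leq : 3 <= diam G -> m <= (2 * d - 1) %/ 3.
Proof.
move=> diam3.
have [u [v duv]] : exists u v : G, 3 <= dist u v.
  have [/existsP [u /existsP [v duv]]|no] :=
      boolP [exists u : G, exists v : G, 3 <= dist u v]; first by exists u, v.
  suff: diam G <= 2 by rewrite leqNgt diam3.
  apply/bigmax_leqP=> u _; apply/bigmax_leqP=> v _.
  move: no; rewrite negb_exists => /forallP /(_ u).
  by rewrite negb_exists => /forallP /(_ v); rewrite -ltnNge.
have [p [pp lp sp]] := reach_dist u v cG.
have size_geq q : path (@edge G) u q -> last u q = v -> dist u v <= size q.
  by move=> /dist_leq_size [+ _] lq; rewrite lq.
case: p pp lp sp => [|x1 [|x2 [|x3 p]]].
- by move=> _ lq; have := size_geq [::] isT lq; rewrite /=; lia.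
- by move=> pq lq; have := size_geq _ pq lq; rewrite /=; lia.
- by move=> pq lq; have := size_geq _ pq lq; rewrite /=; lia.
move=> /= /and4P [e01 e12 e23 pp] lp sp.
suff lt_md : 3 * m < 2 * d by lia.
(* Replacing the first three edges of the geodesic by [q] would give a walk from [u] to [v] shorter
   than [dist u v]. *)
apply: (min_local_deg_dist3 e01 e12 e23) => -[q [pq lq sq]].
have := size_geq (q ++ p); rewrite cat_path pq last_cat lq size_cat pp => /(_ isT lp).
by lia.
Qed.

End UpperBound.

(** * Blowing up each vertex to a clique *)

Section BlowUp.
Variables (C : sgraph) (k : nat).
Let V : finType := (C * 'I_k.+1)%type.

(** The strong product of [C] with the complete graph on [k.+1] vertices. *)
Definition blowup_edge : rel V :=
  fun x y => (x != y) && ((x.1 == y.1) || edge x.1 y.1).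

Fact blowup_sym : symmetric blowup_edge.
Proof. by move=> x y; rewrite /blowup_edge eq_sym edge_sym [x.1 == _]eq_sym. Qed.

Fact blowup_irr : irreflexive blowup_edge.
Proof. by move=> x; rewrite /blowup_edge eqxx. Qed.

Definition blowup : sgraph := SGraph blowup_sym blowup_irr.

Lemma blowup_edgeE (x y : blowup) :
  edge x y = (x != y) && ((x.1 == y.1) || edge x.1 y.1).
Proof. by []. Qed.

Lemma blowup_reach1 n (x : blowup) (z : C) (c : 'I_k.+1) :
  (x.1 == z) || edge x.1 z -> @reach blowup n.+1 x (z, c).
Proof.
move=> xz; have [->|ne] := eqVneq x (z, c); first exact: reach_refl.
by apply: (@reach_edge blowup _ _ (z, c)); [rewrite blowup_edgeE ne | exact: reach_refl].
Qed.

(** A path of [C] lifts with constant second coordinate; one extra step inside the last clique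
    corrects that coordinate. *)
Lemma blowup_connected : connected C -> connected blowup.
Proof.
move=> [C0 cC]; split.
  by rewrite card_prod card_ord muln_gt0 C0.
move=> [i a] [j b]; have /connectP [p pp ->] := cC i j.
suff [q [pq lq _]] : @reach blowup (size p).+1 (i, a) (last i p, b).
  by apply/connectP; exists q.
elim: p i a pp => [|z p IH] i a /=; first by move=> _; apply: blowup_reach1; rewrite eqxx.
case/andP=> iz /(IH z a); apply: reach_edge.
rewrite blowup_edgeE /= iz orbT andbT; apply: contraTneq iz => -[->].
by rewrite edge_irr.
Qed.

(** The closed neighbourhood of [x] consists of [(deg x.1).+1] full cliques. *)
Lemma blowup_deg (x : blowup) : deg x = (deg x.1).+1 * k.+1 - 1.
Proof.
have -> : deg x = #|setX (x.1 |: [set w | edge x.1 w]) [set: 'I_k.+1] :\ x|.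
  congr #|pred_of_set _|; apply/setP=> y.
  by rewrite !inE blowup_edgeE [x == y]eq_sym [x.1 == _]eq_sym andbT.
have := cardsD1 x (setX (x.1 |: [set w | edge x.1 w]) [set: 'I_k.+1]).
rewrite cardsX cardsU1 cardsT card_ord -[#|[set w | _]|]/(deg x.1) !inE eqxx edge_irr.
by rewrite /= add1n => ->; rewrite add1n subn1.
Qed.

(** Take for [j] the clique that the walk leaves when it first enters the clique of [w]. One step
    from its last vertex before the entry reaches all of both cliques. *)
Lemma blowup_reach_adjacent n (v : blowup) (w : blowup) :
  v.1 != w.1 -> @reach blowup n v w ->
  exists2 j : C, edge w.1 j &
    forall c, @reach blowup n v (j, c) /\ @reach blowup n v (w.1, c).
Proof.
move=> + [p [pp lp]]; rewrite -lp {w lp}.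
elim: p n v pp => [|y p IH] n v /=; first by rewrite eqxx.
case/andP=> vy pp ne; case: n => // n sp.
have [eq_y|ne_y] := eqVneq y.1 (last y p).1.
  have evy : edge v.1 y.1.
    by move: vy ne; rewrite /blowup_edge -eq_y => /andP [_] /orP [->|].
  exists v.1; first by rewrite -eq_y edge_sym.
  by move=> c; split; apply: blowup_reach1; rewrite ?eqxx // -eq_y evy orbT.
have [j ej rj] := IH n y pp ne_y sp; exists j => // c.
by have [? ?] := rj c; split; apply: (@reach_edge blowup _ _ y).
Qed.

Lemma blowup_min_local_deg (r : nat) (v : blowup) :
  connected C -> (forall i : C, exists j, edge i j) -> 0 < r ->
  k.*2.+1 <= min_deg (local_graph r v).
Proof.
move=> cC nbr r0; have cB := blowup_connected cC.
have vB := ball_center r v cB.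
apply: (@min_deg_geq (local_graph r v) (Sub v vB : {x | x \in ball r v})) => -[w wB].
rewrite deg_induced /=.
have [j ej rj] : exists2 j : C, edge w.1 j &
    forall c, @reach blowup r v (j, c) /\ @reach blowup r v (w.1, c).
  (* In the clique of the centre, any adjacent clique serves, since [r] is positive. *)
  have [eq_vw|ne] := eqVneq v.1 w.1.
    have [j ej] := nbr w.1; exists j => // c; case: r r0 {vB wB} => // r _.
    by split; apply: blowup_reach1; rewrite eq_vw ?eqxx // ej orbT.
  by apply: blowup_reach_adjacent ne _; move: wB; rewrite inE => /dist_leqP; apply.
have ne_j : w.1 != j by apply: contraTneq ej => <-; rewrite edge_irr.
(* Two full cliques without [w] itself: [2 * (k + 1) - 1] neighbours. *)
have := cardsD1 w (setX [set w.1; j] [set: 'I_k.+1]).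
have -> : w \in setX [set w.1; j] [set: 'I_k.+1] by rewrite !inE eqxx.
rewrite cardsX cards2 ne_j cardsT card_ord /= add1n mul2n => card2.
have sub : setX [set w.1; j] [set: 'I_k.+1] :\ w
    \subset [set x in ball r v | edge w x].
  apply/subsetP=> -[z c]; rewrite !inE andbT /= => /andP [ne_w zj].
  rewrite /blowup_edge eq_sym ne_w /=; apply/andP; split.
    by apply/dist_leqP => //; case/orP: zj => /eqP ->; case: (rj c).
  by case/orP: zj => /eqP ->; rewrite ?eqxx // ej orbT.
apply: leq_trans (subset_leq_card sub).
by rewrite -ltnS -card2 doubleS.
Qed.

End BlowUp.

(** * Cycles *)

Section Cycle.
Variable n : nat.
Let V : finType := 'I_n.+3.

(** With at least three vertices, successor and predecessor differ, so every degree is two. *)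
Definition cycle_edge : rel V := fun i j => (j == ordS i) || (i == ordS j).

Fact cycle_sym : symmetric cycle_edge.
Proof. by move=> i j; rewrite /cycle_edge orbC. Qed.

Lemma val_ordS (i : 'I_n.+3) : ordS i = (if i == n.+2 :> nat then 0 else i.+1) :> nat.
Proof.
have := ltn_ord i; rewrite /=; case: eqP => [->|ne] lt_i; first by rewrite modnn.
by rewrite modn_small //; lia.
Qed.

Lemma eq_ordS (i j : 'I_n.+3) :
  (j == ordS i) = (j == (if i == n.+2 :> nat then 0 else i.+1) :> nat).
Proof. by rewrite -val_ordS. Qed.

Fact cycle_irr : irreflexive cycle_edge.
Proof. by move=> i; rewrite /cycle_edge orbb eq_ordS; case: (_ =P n.+2); lia. Qed.

Definition cycle_graph : sgraph := SGraph cycle_sym cycle_irr.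

Lemma cycle_connected : connected cycle_graph.
Proof.
split; first by rewrite card_ord.
have conn0 i (lt_i : i < n.+3) :
    connect (@edge cycle_graph) (ord0 : 'I_n.+3) (Ordinal lt_i).
  elim: i lt_i => [|i IH] lt_i; first by apply/eq_connect0/val_inj.
  apply: connect_trans (IH (ltnW lt_i)) (connect1 _).
  by rewrite /= /cycle_edge eq_ordS /=; case: (_ =P n.+2); lia.
have symc : connect_sym (@edge cycle_graph) := sym_connect_sym (@edge_sym cycle_graph).
by move=> [u ltu] [v ltv]; apply: connect_trans (conn0 v ltv); rewrite symc.
Qed.

Lemma cycle_regular : regular 2 cycle_graph.
Proof.
move=> v; have -> : deg v = #|[set ordS v; ord_pred v]|.
  congr #|pred_of_set _|; apply/setP=> w; rewrite !inE /= /cycle_edge.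
  by rewrite [v == _]eq_sym (can2_eq (@ordSK _) (@ord_predK _)).
suff ne : ordS v != ord_pred v by rewrite cards2 ne.
rewrite -(inj_eq (can_inj (@ordSK _))) ord_predK eq_sym eq_ordS val_ordS.
have := ltn_ord v.
by case: (_ =P n.+2); case: (_ =P n.+2); lia.
Qed.

(** [minn i (n.+3 - i)] is the distance from [0] to [i] around the cycle. *)
Lemma cycle_height_lipschitz (i j : cycle_graph) : edge i j ->
  minn j (n.+3 - j) <= (minn i (n.+3 - i)).+1.
Proof.
have := ltn_ord i; have := ltn_ord j => ltj lti.
rewrite /= /cycle_edge !eq_ordS.
by case: (_ =P n.+2); case: (_ =P n.+2); rewrite /=; lia.
Qed.

End Cycle.

Theorem theorem4 :
  (forall (d : nat) (G : sgraph),
     connected G -> regular d G -> 3 <= diam G ->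
     exists2 m : nat, is_min_local_deg G m & m <= (2 * d - 1) %/ 3)
  /\
  (forall d D : nat, d = 2 %[mod 3] -> 3 <= D ->
     exists G : sgraph,
       [/\ connected G, regular d G, D <= diam G
         & is_min_local_deg G ((2 * d - 1) %/ 3)]).
Proof.
split=> [d G cG rG diam3|d D d_mod D3].
  have [m min_m] := min_local_deg_exists cG.
  by exists m => //; apply: (min_local_deg_leq cG rG min_m).
pose t := d %/ 3; have def_d : d = 3 * t + 2 by rewrite /t; lia.
(* The [2 * D + 3] vertices leave room for vertex [D] at distance [D] from [0]. *)
pose C := cycle_graph D.*2; pose G := blowup C t.
have cC : connected C := cycle_connected _.
have cG : connected G := blowup_connected _ cC.
have rG : regular d G.
  (* Each degree is [3 * (t + 1) - 1 = d]. *)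
  by move=> x; rewrite blowup_deg cycle_regular; lia.
have diamD : D <= diam G.
  have ltD : D < D.*2.+3 by lia.
  pose u : G := (ord0 : 'I_D.*2.+3, ord0); pose v : G := (Ordinal ltD, ord0).
  pose f (x : G) := minn (x.1 : 'I_D.*2.+3) (D.*2.+3 - (x.1 : 'I_D.*2.+3)).
  have lip (x y : G) : edge x y -> f y <= (f x).+1.
    rewrite blowup_edgeE => /andP [_] /orP [/eqP eq_xy|]; first by rewrite /f eq_xy.
    exact: cycle_height_lipschitz.
  (* Here [f u = 0] and [f v = D]. *)
  have := @dist_lipschitz _ f u v cG lip; rewrite /f /= => le_d.
  apply: leq_trans (leq_bigmax u); apply: leq_trans (leq_bigmax v).
  by move: le_d; lia.
exists G; split=> //; have [m min_m] := min_local_deg_exists cG.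
suff <- : m = (2 * d - 1) %/ 3 by [].
apply/eqP; rewrite eqn_leq (min_local_deg_leq cG rG min_m) /=; last exact: leq_trans diamD.
have [[v [r [r0 ->]]] _] := min_m.
(* As [2 * d - 1 = 6 * t + 3], the quotient is the bound of [blowup_min_local_deg] for cliques of
   size [t + 1]. *)
have -> : (2 * d - 1) %/ 3 = t.*2.+1 by lia.
apply: blowup_min_local_deg => // i.
have : 0 < deg i by rewrite cycle_regular.
by case/card_gt0P=> j; rewrite inE; exists j.
Qed.
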